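(* Let $m,r\ge1$ be integers, let $g(t)=\sum_{n\ge0}g_n\frac{t^n}{n!}$ be a formal power series with $g_0\ne0$, put $A(t)=1/g(t)$, let ${}_{{}_LH^{(m,r)}}A_n(x,y,z)$ $(n\ge0)$ be the associated Laguerre-Gould Hopper based Appell polynomials, and let ${}_{{}_mL}A_n(x,y)$ be the associated 2-variable generalized Laguerre based Appell polynomials. Then for every $n\ge0$ $${}_{{}_LH^{(m,r)}}A_n(x,y,z)=\exp\left(z\frac{\partial^r}{\partial y^r}\right){}_{{}_mL}A_n(x,y).$$
   Context: Coefficients are real (or complex) numbers. The Laguerre-Gould Hopper based Appell polynomials are defined by the formal generating function $$A(t)\,C_0(-xt^m)\exp(yt+zt^r)=\sum_{n=0}^{\infty}{}_{{}_LH^{(m,r)}}A_n(x,y,z)\frac{t^n}{n!},\qquad A(t)=\frac{1}{g(t)},$$ where $C_0(x)=\sum_{k\ge0}\frac{(-1)^kx^k}{(k!)^2}$ is the Bessel-Tricomi function of order zero. The 2-variable generalized Laguerre based Appell polynomials are the special case $z=0$: ${}_{{}_mL}A_n(x,y):={}_{{}_LH^{(m,r)}}A_n(x,y,0)$, i.e. $A(t)C_0(-xt^m)\exp(yt)=\sum_{n\ge0}{}_{{}_mL}A_n(x,y)\frac{t^n}{n!}$. The exponential of an operator is given by its power series, which is a finite sum when applied to a polynomial in $y$. *)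

(* Defs.v *)
From HB Require Import structures.
From mathcomp Require Import all_boot all_order all_algebra.
From mathcomp.multinomials Require Import mpoly.

Set Implicit Arguments.
Unset Strict Implicit.
Unset Printing Implicit Defensive.

Import Order.TTheory GRing.Theory Num.Theory.
Local Open Scope ring_scope.

(* A formal power series [\sum_n a_n t^n] over S is its coefficient sequence
   [a : nat -> S]. *)
Section FormalSeries.
Variables (K : numFieldType) (S : comAlgType K).

Definition fps_one : nat -> S := fun n => (n == 0%N)%:R.

Definition fps_monom (c : S) (d : nat) : nat -> S :=
  fun n => if n == d then c else 0.

Definition fps_add (a b : nat -> S) : nat -> S := fun n => a n + b n.

Definition fps_mul (a b : nat -> S) : nat -> S :=
  fun n => \sum_(k < n.+1) a k * b (n - k)%N.

Definition fps_pow (a : nat -> S) (k : nat) : nat -> S :=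
  iter k (fps_mul a) fps_one.

(* [f(h(t)) = \sum_k f_k h(t)^k], for h without constant term: then [h(t)^k]
   has no term of degree less than k, so k <= n suffices in degree n. *)
Definition fps_comp (f : nat -> K) (h : nat -> S) : nat -> S :=
  fun n => \sum_(k < n.+1) f k *: fps_pow h k n.

Definition fps_exp (h : nat -> S) : nat -> S :=
  fps_comp (fun k => (k`!%:R)^-1) h.

(* The Bessel-Tricomi function C_0 composed with h. *)
Definition fps_bessel0 (h : nat -> S) : nat -> S :=
  fps_comp (fun k => (-1) ^+ k / (k`!%:R) ^+ 2) h.

Definition fps_of_base (a : nat -> K) : nat -> S := fun n => (a n)%:A.

End FormalSeries.

(* The first n coefficients of 1/a(t), by the usual recursion
   [b_n = a_0^-1 * ([n = 0] - \sum_(k < n) a_(k+1) b_(n-k-1))]. *)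
Fixpoint fps_inv_prefix (K : numFieldType) (a : nat -> K) (n : nat) : seq K :=
  if n is n'.+1 then
    let s := fps_inv_prefix a n' in
    rcons s ((a 0%N)^-1
             * ((n' == 0%N)%:R - \sum_(k < n') a k.+1 * s`_(n' - k.+1)%N))
  else [::].

Definition fps_inv (K : numFieldType) (a : nat -> K) : nat -> K :=
  fun n => (fps_inv_prefix a n.+1)`_n.

(* A(t) = 1/g(t), where g(t) = \sum_n g_n t^n / n!. *)
Definition appell_A (K : numFieldType) (g : nat -> K) : nat -> K :=
  fps_inv (fun n => g n / n`!%:R).

Section Appell.
Variables (K : numFieldType) (S : comAlgType K).

(* A(t) C_0(-x t^m) exp(y t + z t^r) *)
Definition LH_genfun (m r : nat) (g : nat -> K) (x y z : S) : nat -> S :=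
  fps_mul (fps_mul (fps_of_base S (appell_A g))
                   (fps_bessel0 (fps_monom (- x) m)))
          (fps_exp (fps_add (fps_monom y 1) (fps_monom z r))).

Definition LH_appell (m r : nat) (g : nat -> K) (x y z : S) (n : nat) : S :=
  n`!%:R * LH_genfun m r g x y z n.

(* A(t) C_0(-x t^m) exp(y t); see [L_appellE] for the specialization z = 0. *)
Definition L_genfun (m : nat) (g : nat -> K) (x y : S) : nat -> S :=
  fps_mul (fps_mul (fps_of_base S (appell_A g))
                   (fps_bessel0 (fps_monom (- x) m)))
          (fps_exp (fps_monom y 1)).

Definition L_appell (m : nat) (g : nat -> K) (x y : S) (n : nat) : S :=
  n`!%:R * L_genfun m g x y n.

End Appell.

Definition ix : 'I_3 := @Ordinal 3 0 isT.
Definition iy : 'I_3 := @Ordinal 3 1 isT.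
Definition iz : 'I_3 := @Ordinal 3 2 isT.

Section ExpOperator.
Variable K : numFieldType.
Implicit Types p : {mpoly K[3]}.

Definition z_dy (r : nat) p : {mpoly K[3]} := 'X_iz * p^`M(iy, r).

Definition op_exp_trunc (D : {mpoly K[3]} -> {mpoly K[3]}) (N : nat) p :
  {mpoly K[3]} := \sum_(k < N) (k`!%:R)^-1 *: iter k D p.

(* For r >= 1 all later terms of the exponential series vanish on p: see
   [exp_z_dyE]. *)
Definition exp_z_dy (r : nat) p : {mpoly K[3]} :=
  op_exp_trunc (z_dy r) (msize p) p.

End ExpOperator.

Section Checks.
Variable K : numFieldType.

Lemma size_fps_inv_prefix (a : nat -> K) n : size (fps_inv_prefix a n) = n.
Proof. by elim: n => //= n IHn; rewrite size_rcons IHn. Qed.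

Lemma nth_fps_inv_prefix (a : nat -> K) n i :
  (i < n)%N -> (fps_inv_prefix a n)`_i = fps_inv a i.
Proof.
elim: n => // n IHn; rewrite ltnS leq_eqVlt => /orP[/eqP -> //|lt_in].
by rewrite /= nth_rcons size_fps_inv_prefix lt_in IHn.
Qed.

Lemma fps_invE (a : nat -> K) n :
  fps_inv a n
  = (a 0%N)^-1 * ((n == 0%N)%:R - \sum_(k < n) a k.+1 * fps_inv a (n - k.+1)%N).
Proof.
rewrite {1}/fps_inv /= nth_rcons size_fps_inv_prefix ltnn eqxx.
congr (_ * (_ - _)); apply: eq_bigr => k _.
by rewrite nth_fps_inv_prefix // ltn_subrL (leq_ltn_trans _ (ltn_ord k)).
Qed.

Lemma fps_mulV (a : nat -> K) :
  a 0%N != 0 -> fps_mul (S := K^o) a (fps_inv a) =1 fps_one K^o.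
Proof.
move=> a0 n; rewrite /fps_mul /fps_one big_ord_recl subn0 fps_invE.
by rewrite mulVKf // subrK.
Qed.

Lemma L_appellE (S : comAlgType K) m r (g : nat -> K) (x y : S) n :
  L_appell m g x y n = LH_appell m r g x y 0 n.
Proof.
have powE (h h' : nat -> S) k : h =1 h' -> fps_pow h k =1 fps_pow h' k.
  move=> eqh; elim: k => //= k IHk i.
  by apply: eq_bigr => j _; rewrite eqh IHk.
congr (_ * _); apply: eq_bigr => k _; congr (_ * _).
apply: eq_bigr => j _; congr (_ *: _); apply: powE => i.
by rewrite /fps_add {3}/fps_monom if_same addr0.
Qed.

Lemma iter_z_dy r k (p : {mpoly K[3]}) :
  iter k (z_dy r) p = 'X_iz ^+ k * p^`M(iy, (k * r)%N).
Proof.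
have dz j (q : {mpoly K[3]}) : ('X_iz ^+ j * q)^`M(iy) = 'X_iz ^+ j * q^`M(iy).
  rewrite mderivM mpolyXn mderivX mulmnE mnm1E /= mul0n scale0r mul0r.
  by rewrite add0r.
have dzn i j (q : {mpoly K[3]}) :
    ('X_iz ^+ j * q)^`M(iy, i) = 'X_iz ^+ j * q^`M(iy, i).
  by elim: i q => [|i IHi] q; rewrite ?mderivn0 // !mderivSn dz IHi.
elim: k => [|k IHk]; first by rewrite mul0n mderivn0 expr0 mul1r.
rewrite iterS IHk /z_dy dzn mulrA -exprS; congr (_ * _).
by rewrite !mderivn_iter mulSn iterD.
Qed.

Lemma exp_z_dyE r N (p : {mpoly K[3]}) : (0 < r)%N -> (msize p <= N)%N ->
  op_exp_trunc (z_dy r) N p = exp_z_dy r p.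
Proof.
move=> r_gt0 leN; rewrite /exp_z_dy /op_exp_trunc.
rewrite [RHS](big_ord_widen N (fun k => (k`!%:R)^-1 *: iter k (z_dy r) p)) //.
rewrite [LHS](bigID (fun k : 'I_N => (k < msize p)%N)) /=.
rewrite [X in _ + X = _]big1 ?addr0 //.
move=> k; rewrite -leqNgt => lek; rewrite iter_z_dy mderivnE.
rewrite big_seq big1 ?mulr0 ?scaler0 // => m /msize_mdeg_lt ltm.
rewrite ffact_small ?mulr0n ?mul0r ?mulr0 ?scale0r //.
apply: leq_trans (leq_trans lek (leq_pmulr _ r_gt0)).
apply: leq_ltn_trans ltm; rewrite mdegE (bigD1 iy) //=; exact: leq_addr.
Qed.

End Checks.

(* Main.v *)
(* The factor A(t) C_0(-x t^m) has coefficients free of y, so they commute with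
   z d^r/dy^r, and the claim reduces to
   exp(z d^r/dy^r) exp(y t) = exp(y t + z t^r).  In degree n both sides are the
   sum over i with i r <= n of z^i y^(n - i r) / (i! (n - i r)!): on the left by
   differentiating y^n / n!, on the right by the binomial theorem. *)
Require Import Defs.
From mathcomp Require Import all_boot all_order all_algebra.
From mathcomp.multinomials Require Import mpoly.

Local Open Scope ring_scope.

Set Implicit Arguments.
Unset Strict Implicit.

Import GRing.Theory Num.Theory.

(** Passage to [{poly S}], where the binomial theorem and the coefficient rules for ['X^k] apply. *)
Lemma fps_pow_coef (K : numFieldType) (S : comAlgType K) (h : nat -> S)
    (p : {poly S}) :
  (forall i, h i = p`_i) -> forall k i, fps_pow h k i = (p ^+ k)`_i.
Proof.
move=> hp; elim=> [|k IHk] i; first by rewrite expr0 coef1.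
by rewrite exprS coefM; apply: eq_bigr => j _; rewrite hp -IHk.
Qed.

Lemma fps_exp_monom (K : numFieldType) (S : comAlgType K) (y : S) n :
  fps_exp (fps_monom y 1) n = (n`!%:R)^-1 *: y ^+ n.
Proof.
have hp i : fps_monom y 1 i = (y *: 'X)`_i.
  by rewrite coefZ coefX /fps_monom; case: eqP; rewrite ?mulr1 ?mulr0.
rewrite /fps_exp /fps_comp big_ord_recr big1 /= => [|k _].
  by rewrite add0r (fps_pow_coef hp) exprZn coefZ coefXn eqxx mulr1.
by rewrite (fps_pow_coef hp) exprZn coefZ coefXn gtn_eqF // mulr0 scaler0.
Qed.

(** The [i]-th binomial term of [(y t + z t^r)^k] has [t]-degree [k - i + i r], so each [i] meets
    degree [n] for at most one [k]. The free bound [N] lets the sum be compared term by term with a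
    truncated operator exponential. *)
Lemma fps_exp_monomD (K : numFieldType) (S : comAlgType K) (y z : S) r n N :
  (0 < r)%N -> (n < N)%N ->
  fps_exp (fps_add (fps_monom y 1) (fps_monom z r)) n
  = \sum_(i < N | (i * r <= n)%N)
      (i`!%:R * (n - i * r)`!%:R)^-1 *: (z ^+ i * y ^+ (n - i * r)).
Proof.
move=> r_gt0 ltnN.
have hp i : fps_add (fps_monom y 1) (fps_monom z r) i
            = (y *: 'X + z *: 'X^r)`_i.
  rewrite coefD !coefZ coefX coefXn /fps_add /fps_monom.
  by do 2!case: eqP; rewrite ?mulr1 ?mulr0.
(* [F k i] is the degree [n] part of the [i]-th binomial term of the [k]-th power, divided by [k!].
   Since ['C(k, i) = 0] for [i > k], the range of [i] can be widened to [N], independent of [k], and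
   the two sums exchanged. *)
pose F k i : S := (k`!%:R)^-1 *:
  (z ^+ i * y ^+ (k - i) *+ 'C(k, i) * (n == (k - i) + i * r)%N%:R).
have -> : fps_exp (fps_add (fps_monom y 1) (fps_monom z r)) n
          = \sum_(k < n.+1) \sum_(i < N) F k i.
  apply: eq_bigr => k _; rewrite (fps_pow_coef hp) exprDn coef_sum scaler_sumr.
  rewrite (big_ord_widen N (fun i => _ *:
    ((y *: 'X) ^+ (k - i) * (z *: 'X^r) ^+ i *+ 'C(k, i))`_n)); last first.
    exact: leq_trans ltnN.
  rewrite big_mkcond; apply: eq_bigr => i _; rewrite /F ltnS.
  case: leqP => [_|ltki]; last by rewrite bin_small // mulr0n mul0r scaler0.
  rewrite !exprZn -scalerAl -scalerAr scalerA -exprM -exprD coefMn coefZ coefXn.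
  by rewrite [(r * i)%N]mulnC mulrnAl [y ^+ _ * _]mulrC.
rewrite exchange_big [RHS]big_mkcond; apply: eq_bigr => i _ /=.
have Fnz k : F k i != 0 -> (i <= k)%N /\ n = (k - i + i * r)%N.
  move=> Fki; split; last first.
    by apply: contraNeq Fki => /negPf eqn; rewrite /F eqn mulr0 scaler0.
  apply: contraNT Fki; rewrite -ltnNge => ltki.
  by rewrite /F bin_small // mulr0n mul0r scaler0.
case: leqP => [le_irn|lt_nir]; last first.
  apply: big1 => k _; apply/eqP/contraT => /Fnz[_ def_n].
  by rewrite def_n ltnNge leq_addl in lt_nir.
(* As [r >= 1], the index [n - i r + i] does not exceed [n], so it lies in the range of [k]. *)
have le_ir : (i <= i * r)%N by rewrite leq_pmulr.
have ltk0 : (n - i * r + i < n.+1)%N.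
  by rewrite ltnS -{2}(subnK le_irn) leq_add2l.
(* The only k contributing to degree n satisfies k - i + i * r = n. *)
rewrite (bigD1 (Ordinal ltk0)) //= big1 ?addr0 => [|k].
  rewrite /F addnK subnK // eqxx mulr1 -scaler_nat scalerA; congr (_ *: _).
  have := bin_fact (leq_addl (n - i * r) i); rewrite addnK => <-.
  rewrite natrM natrM invfM mulrAC mulVf ?mul1r //.
  by rewrite pnatr_eq0 -lt0n bin_gt0 leq_addl.
apply: contraNeq => /Fnz[leik def_n]; apply/eqP/val_inj => /=.
by rewrite [in RHS]def_n addnK subnK.
Qed.

Section YConstants.

Variable K : numFieldType.
Implicit Types (p c : {mpoly K[3]}) (a b h : nat -> {mpoly K[3]}).

(** Freeness of [y] is stated through the derivative, the form in which the Leibniz rule uses it. *)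
Definition yconst a := forall i, (a i)^`M(iy) = 0.

Lemma yconst_mul a b : yconst a -> yconst b -> yconst (fps_mul a b).
Proof.
move=> ha hb i; rewrite raddf_sum big1 // => j _.
by rewrite /= mderivM ha hb mul0r mulr0 addr0.
Qed.

Lemma yconst_comp (f : nat -> K) h : yconst h -> yconst (fps_comp f h).
Proof.
move=> hh i; rewrite raddf_sum big1 // => k _ /=.
rewrite mderivZ; suff -> : yconst (fps_pow h k) by rewrite scaler0.
elim: {k}(k : nat) => [|k IHk] /=; last exact: yconst_mul.
by move=> j; rewrite /fps_one -[_%:R]mpolyC_nat mderivC.
Qed.

Lemma mderivn_constM c p d :
  c^`M(iy) = 0 -> (c * p)^`M(iy, d) = c * p^`M(iy, d).
Proof.
move=> hc; elim: d p => [|d IHd] p; first by rewrite !mderivn0.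
by rewrite !mderivSn mderivM hc mul0r add0r IHd.
Qed.

(** For [d > n] the falling factorial is zero, so the truncated exponent [n - d] does no harm. *)
Lemma mderivn_expX n d :
  ('X_iy ^+ n : {mpoly K[3]})^`M(iy, d) = (n ^_ d)%:R *: 'X_iy ^+ (n - d).
Proof.
rewrite mpolyXn mderivnX mpolyXn mulmnE mnm1E eqxx mul1n.
have [ltnd|ledn] := ltnP n d; first by rewrite ffact_small // !scale0r.
congr (_ *: 'X_[_]); apply/mnmP => j; rewrite mnmBE !mulmnE.
by rewrite mulnBr.
Qed.

(** Every iterate [z^k d^(k r)/dy^(k r)] is linear over the [y]-free coefficients. The order [N] is
    the same for all summands, whereas that of [exp_z_dy] would vary with its argument. *)
Lemma op_exp_z_dy_sum r N (I : Type) (s : seq I) (c p : I -> {mpoly K[3]}) :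
  (forall i, (c i)^`M(iy) = 0) ->
  op_exp_trunc (z_dy r) N (\sum_(i <- s) c i * p i)
  = \sum_(i <- s) c i * op_exp_trunc (z_dy r) N (p i).
Proof.
move=> hc; under [RHS]eq_bigr do rewrite mulr_sumr.
rewrite exchange_big; apply: eq_bigr => k _.
rewrite iter_z_dy raddf_sum mulr_sumr scaler_sumr; apply: eq_bigr => i _.
by rewrite /= mderivn_constM // iter_z_dy mulrCA scalerAr.
Qed.

(** The sums agree index by index: [n ^_ (i r) / n! = 1 / (n - i r)!] when [i r <= n], and the
    derivative vanishes otherwise. *)
Lemma fps_exp_op_exp_z_dy r n N : (0 < r)%N -> (n < N)%N ->
  fps_exp (fps_add (fps_monom ('X_iy : {mpoly K[3]}) 1) (fps_monom 'X_iz r)) n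
  = op_exp_trunc (z_dy r) N (fps_exp (fps_monom 'X_iy 1) n).
Proof.
move=> r_gt0 ltnN; rewrite (@fps_exp_monomD _ _ _ _ _ _ N) // fps_exp_monom.
rewrite big_mkcond; apply: eq_bigr => i _ /=.
rewrite iter_z_dy mderivmZ mderivn_expX; case: leqP => [le_irn|lt_nir].
  rewrite scalerA -scalerAr scalerA; congr (_ *: _).
  have nz k : (k`!%:R : K) != 0 by rewrite pnatr_eq0 -lt0n fact_gt0.
  rewrite -(ffact_fact le_irn) natrM !invfM; congr (_ * _).
  rewrite mulrAC mulVf ?mul1r //.
  by rewrite pnatr_eq0 -lt0n ffact_gt0.
by rewrite ffact_small // scale0r scaler0 mulr0 scaler0.
Qed.

End YConstants.

Unset Implicit Arguments.
Set Strict Implicit.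

Theorem theorem2p5 (K : numFieldType) (m r : nat)
  (hm : (1 <= m)%N) (hr : (1 <= r)%N)
  (g : nat -> K) (hg : g 0%N != 0) (n : nat) :
  LH_appell m r g ('X_ix : {mpoly K[3]}) 'X_iy 'X_iz n
  = exp_z_dy r (L_appell m g ('X_ix : {mpoly K[3]}) 'X_iy n).
Proof.
(* One order for all terms: large enough for truncation at [N] to give the full exponential, and
   above every degree [n - k] of the factor [exp(y t)]. *)
pose N := maxn n.+1 (msize (L_appell m g ('X_ix : {mpoly K[3]}) 'X_iy n)).
rewrite -(@exp_z_dyE _ _ N) ?leq_maxr // /L_appell /L_genfun.
set b := fps_mul _ (fps_bessel0 _).
have hb : yconst b.
  apply: yconst_mul => [i|]; first by rewrite mderivZ -mpolyC1 mderivC scaler0.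
  apply: yconst_comp => i; rewrite /fps_monom; case: eqP; rewrite ?mderiv0 //.
  by rewrite mderivN mderivX mnm1E scale0r oppr0.
rewrite [fps_mul b _ n]/fps_mul mulr_sumr.
(* The constant [n!] joins the coefficient of [b], giving a sum with [y]-free left factors. *)
under [in RHS]eq_bigr do rewrite mulrA.
rewrite op_exp_z_dy_sum => [|i]; last first.
  by rewrite mderivM hb mulr0 addr0 -mpolyC_nat mderivC mul0r.
rewrite /LH_appell /LH_genfun -/b {1}/fps_mul mulr_sumr.
apply: eq_bigr => k _; rewrite mulrA; congr (_ * _).
apply: fps_exp_op_exp_z_dy => //.
by rewrite leq_max ltnS leq_subr.
Qed.
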